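(* The symmetric bilinear form $(\ ,\ )$ on $\mathcal N_q^-$ is non-degenerate: if $u\in\mathcal N_q^-$ satisfies $(u,v)=0$ for all $v\in\mathcal N_q^-$, then $u=0$.
   Context: Let $\mathbb F$ be a field of characteristic zero and $q$ an indeterminate. Let $\mathcal N_q^-$ be the associative unital $\mathbb F(q^{1/2})$-algebra generated by $x_n^-$ ($n\in\mathbb Z$) with relations $$x^-_{k+1}x^-_l-q^{-2}x^-_lx^-_{k+1}=q^{-2}x^-_kx^-_{l+1}-x^-_{l+1}x^-_k\qquad(k,l\in\mathbb Z).$$ (This is the subalgebra of $U_q(\widehat{\mathfrak{sl}(2)})$, in Drinfeld's realization, generated by the $x_n^-$ and the central elements $\gamma^{\pm1/2}$, with $\gamma^{1/2}$ set equal to $1$.) The ordered monomials $x^-_{i_1}\cdots x^-_{i_k}$ with $k\ge0$, $i_1\ge\cdots\ge i_k$, form an $\mathbb F(q^{1/2})$-basis of $\mathcal N_q^-$. Let $g_{q^{-1}}(t)=\sum_{r\ge0}g_{q^{-1}}(r)t^r$ be the Taylor series at $t=0$ of $(q^{-2}t-1)/(t-q^{-2})$; explicitly $g_{q^{-1}}(0)=q^2$ and $g_{q^{-1}}(r)=(q^4-1)q^{2(r-1)}$ for $r>0$. The operators $\Omega_\psi(k):\mathcal N_q^-\to\mathcal N_q^-$, $k\in\mathbb Z$, are the $\mathbb F(q^{1/2})$-linear operators given by the generating function $\Omega_\psi(u)=\sum_k\Omega_\psi(k)u^{-k}$ through $$\Omega_\psi(u)\big(x^-(v_1)\cdots x^-(v_k)\big)=\sum_{l=1}^k\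 \prod_{j=1}^{l-1}g_{q^{-1}}(v_j/v_l)\ x^-(v_1)\cdots x^-(v_{l-1})x^-(v_{l+1})\cdots x^-(v_k)\,\delta(u/v_l),$$ where $x^-(v)=\sum_m x^-_mv^{-m}$ and $\delta(z)=\sum_{k\in\mathbb Z}z^k$. Equivalently, $\Omega_\psi(k)(1)=0$ and $$\Omega_\psi(k)(x^-_ma)=\delta_{k,-m}a+\sum_{r\ge0}g_{q^{-1}}(r)\,x^-_{m+r}\,\Omega_\psi(k-r)(a)\qquad(a\in\mathcal N_q^-),$$ where the sum is finite because $\Omega_\psi(k-r)(a)=0$ for $r$ large. It is known that there is a unique symmetric $\mathbb F(q^{1/2})$-bilinear form $(\ ,\ ):\mathcal N_q^-\times\mathcal N_q^-\to\mathbb F(q^{1/2})$ satisfying $(1,1)=1$ and $(x_m^-a,b)=(a,\Omega_\psi(-m)b)$ for all $m\in\mathbb Z$ and $a,b\in\mathcal N_q^-$; this is the form $(\ ,\ )$. *)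

(* Defs.v *)
From HB Require Import structures.
From mathcomp Require Import all_boot all_order all_algebra.
From mathcomp Require Import generic_quotient ring_quotient sesquilinear.
From mathcomp Require Import finmap boolp.
From mathcomp Require Import multinomials.monalg.

Set Implicit Arguments.
Unset Strict Implicit.
Unset Printing Implicit Defensive.

Import GRing.Theory.
Local Open Scope ring_scope.
Local Open Scope quotient_scope.

Inductive in_ideal_gen (R : nzRingType) (S : R -> Prop) : R -> Prop :=
| ideal_gen_in a : S a -> in_ideal_gen S a
| ideal_gen_0 : in_ideal_gen S 0
| ideal_gen_add a b :
    in_ideal_gen S a -> in_ideal_gen S b -> in_ideal_gen S (a + b)
| ideal_gen_mull a b : in_ideal_gen S b -> in_ideal_gen S (a * b)
| ideal_gen_mulr a b : in_ideal_gen S a -> in_ideal_gen S (a * b).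

Definition ideal_gen (R : nzRingType) (S : R -> Prop) : {pred R} :=
  fun a => `[< in_ideal_gen S a >].

Section IdealGen.
Variables (R : nzRingType) (S : R -> Prop).

Lemma ideal_genP a : reflect (in_ideal_gen S a) (a \in ideal_gen S).
Proof. exact: asboolP. Qed.

Lemma ideal_gen_zmod_closed : zmod_closed (ideal_gen S).
Proof.
split=> [|a b /ideal_genP Ia /ideal_genP Ib]; apply/ideal_genP.
  exact: ideal_gen_0.
by rewrite -mulN1r; apply: ideal_gen_add => //; apply: ideal_gen_mull.
Qed.

HB.instance Definition _ :=
  GRing.isZmodClosed.Build R (ideal_gen S) ideal_gen_zmod_closed.

Lemma ideal_genMl a b : b \in ideal_gen S -> a * b \in ideal_gen S.
Proof. by move=> /ideal_genP Ib; apply/ideal_genP; apply: ideal_gen_mull. Qed.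

Lemma ideal_genMr a b : a \in ideal_gen S -> a * b \in ideal_gen S.
Proof. by move=> /ideal_genP Ia; apply/ideal_genP; apply: ideal_gen_mulr. Qed.

End IdealGen.

(* F(q^{1/2}): the polynomial indeterminate 'X stands for q^{1/2}. *)
Definition qfield (F : fieldType) := {fraction {poly F}}.
HB.instance Definition _ (F : fieldType) := GRing.Field.on (qfield F).

Definition qhalf (F : fieldType) : qfield F := tofrac 'X.
Definition qvar (F : fieldType) : qfield F := qhalf F ^+ 2.

Definition freealg (F : fieldType) := {malg (qfield F)[{fmonom int}]}.
HB.instance Definition _ (F : fieldType) := GRing.Lalgebra.on (freealg F).

Definition freegen (F : fieldType) (n : int) : freealg F :=
  mkmalgU (fmu n) 1.

Definition Nrel (F : fieldType) (k l : int) : freealg F :=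
  (freegen F (k + 1) * freegen F l
     - qvar F ^- 2 *: (freegen F l * freegen F (k + 1)))
  - (qvar F ^- 2 *: (freegen F k * freegen F (l + 1))
     - freegen F (l + 1) * freegen F k).

Definition Nideal (F : fieldType) : {pred freealg F} :=
  ideal_gen (fun a => exists k l, a = Nrel F k l).
HB.instance Definition _ (F : fieldType) := GRing.ZmodClosed.on (@Nideal F).

Definition Nq (F : fieldType) := Quotient.quot (@Nideal F).
HB.instance Definition _ (F : fieldType) := GRing.Zmodule.on (Nq F).

Lemma malg_scaleAr (M : monomType) (R : comNzRingType) c
  (a b : {malg R[M]}) : c *: (a * b) = a * (c *: b).
Proof.
rewrite -[c *: b]mul_malgC -[c *: (a * b)]mul_malgC !mulrA; congr (_ * b).
rewrite mul_malgC malgZ_def [RHS](fgmulgU c mone a).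
by apply: eq_bigr => k _; rewrite mulm1 mulrC.
Qed.

Definition piN (F : fieldType) : freealg F -> Nq F :=
  \pi_(Quotient.quot (@Nideal F)).
Definition reprN (F : fieldType) : Nq F -> freealg F :=
  @repr _ (Quotient.quot (@Nideal F)).

(* Locked so that unification does not unfold the quotient construction. *)
HB.lock Definition mulN (F : fieldType) (x y : Nq F) : Nq F :=
  piN (reprN x * reprN y).
HB.lock Definition scaleN (F : fieldType) (c : qfield F) (x : Nq F) : Nq F :=
  piN (c *: reprN x).

Section NqAlgebra.
Variable F : fieldType.
Local Notation K := (qfield F).
Local Notation A := (freealg F).
Local Notation N := (Nq F).
Local Notation piN := (@piN F).
Local Notation reprN := (@reprN F).

Lemma reprNK : cancel reprN piN.
Proof. by move=> x; apply: reprK. Qed.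

Lemma piN_eq (a b : A) : piN a = piN b <-> a - b \in @Nideal F.
Proof.
rewrite Quotient.idealrBE; split=> [/eqP|/eqP]; exact.
Qed.

Lemma piNB : {morph piN : a b / a - b}.
Proof. exact: (raddfB \pi_(Quotient.quot (@Nideal F))). Qed.

Lemma piN_is_zmod_morphism : zmod_morphism piN.
Proof. exact: piNB. Qed.
HB.instance Definition _ :=
  GRing.isZmodMorphism.Build A N piN piN_is_zmod_morphism.

Lemma reprN_pi a : reprN (piN a) - a \in @Nideal F.
Proof. by apply/piN_eq; rewrite reprNK. Qed.

Lemma piN_mul a b : mulN (piN a) (piN b) = piN (a * b).
Proof.
rewrite mulN.unlock; apply/piN_eq.
have -> : reprN (piN a) * reprN (piN b) - a * b =
  (reprN (piN a) - a) * reprN (piN b) + a * (reprN (piN b) - b).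
  by rewrite mulrBl mulrBr addrA subrK.
apply: rpredD; [apply: ideal_genMr | apply: ideal_genMl]; exact: reprN_pi.
Qed.

Lemma piN_scale c a : scaleN c (piN a) = piN (c *: a).
Proof.
rewrite scaleN.unlock; apply/piN_eq; rewrite -scalerBr -[X in c *: X]mul1r scalerAl.
apply: ideal_genMl; exact: reprN_pi.
Qed.

(* Nideal lies in the augmentation ideal of the free algebra. *)
Lemma Nideal_augm a : a \in @Nideal F -> mcoeff mone a = 0.
Proof.
have gen0 n : mcoeff mone (freegen F n) = 0.
  by rewrite mcoeffU; case: eqP => // /(congr1 (@fmonom_val int)); rewrite fm1 fmU.
have augM (b c : A) : mcoeff mone (b * c) = mcoeff mone b * mcoeff mone c.
  by case: (@mcoeff1g_is_multiplicative {fmonom int} K) => augM _; apply: augM.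
move=> /ideal_genP; elim=> {a} [a [k [l ->]]||a b _ IHa _ IHb|a b _ IH|a b _ IH].
- by rewrite /Nrel !(mcoeffB, mcoeffZ, augM) !gen0 !(mul0r, mulr0, subr0).
- exact: mcoeff0.
- by rewrite mcoeffD IHa IHb addr0.
- by rewrite augM IH mulr0.
- by rewrite augM IH mul0r.
Qed.

Lemma mulNA : associative (@mulN F).
Proof.
move=> x y z; rewrite -[x]reprNK -[y]reprNK -[z]reprNK.
by rewrite !piN_mul mulrA.
Qed.

Lemma mul1N : left_id (piN 1) (@mulN F).
Proof. by move=> x; rewrite -[x]reprNK piN_mul mul1r. Qed.

Lemma mulN1 : right_id (piN 1) (@mulN F).
Proof. by move=> x; rewrite -[x]reprNK piN_mul mulr1. Qed.

Lemma mulNDl : left_distributive (@mulN F) +%R.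
Proof.
move=> x y z; rewrite -[x]reprNK -[y]reprNK -[z]reprNK.
by rewrite -raddfD !piN_mul -raddfD mulrDl.
Qed.

Lemma mulNDr : right_distributive (@mulN F) +%R.
Proof.
move=> x y z; rewrite -[x]reprNK -[y]reprNK -[z]reprNK.
by rewrite -raddfD !piN_mul -raddfD mulrDr.
Qed.

Lemma oneN_neq0 : piN 1 != 0.
Proof.
apply/eqP; rewrite -(raddf0 piN) => /piN_eq /Nideal_augm /eqP.
by rewrite subr0 mcoeff1 eqxx oner_eq0.
Qed.

HB.instance Definition _ := GRing.Zmodule_isNzRing.Build N
  mulNA mul1N mulN1 mulNDl mulNDr oneN_neq0.

Lemma piN_is_monoid_morphism : monoid_morphism piN.
Proof. by split=> [|a b]; [|exact: esym (piN_mul a b)]. Qed.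
HB.instance Definition _ :=
  GRing.isMonoidMorphism.Build A N piN piN_is_monoid_morphism.

Lemma scaleNA c d (x : N) : scaleN c (scaleN d x) = scaleN (c * d) x.
Proof. by rewrite -[x]reprNK !piN_scale scalerA. Qed.

Lemma scale1N : left_id 1 (@scaleN F).
Proof. by move=> x; rewrite -[x]reprNK piN_scale scale1r. Qed.

Lemma scaleNDr : right_distributive (@scaleN F) +%R.
Proof.
move=> c x y; rewrite -[x]reprNK -[y]reprNK.
by rewrite -raddfD !piN_scale -raddfD scalerDr.
Qed.

Lemma scaleNDl (x : N) : {morph (@scaleN F)^~ x : c d / c + d}.
Proof. by move=> c d; rewrite -[x]reprNK !piN_scale -raddfD scalerDl. Qed.

HB.instance Definition _ := GRing.Zmodule_isLmodule.Build K N
  scaleNA scale1N scaleNDr scaleNDl.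

Lemma piN_is_scalable : scalable piN.
Proof. by move=> c a; exact: esym (piN_scale c a). Qed.
HB.instance Definition _ :=
  GRing.isScalable.Build K A N *:%R piN piN_is_scalable.

Lemma scaleNAl c (x y : N) : scaleN c (mulN x y) = mulN (scaleN c x) y.
Proof.
rewrite -[x]reprNK -[y]reprNK.
by rewrite !(piN_scale, piN_mul) scalerAl.
Qed.

HB.instance Definition _ := GRing.Lmodule_isLalgebra.Build K N scaleNAl.

Lemma scaleNAr c (x y : N) : scaleN c (mulN x y) = mulN x (scaleN c y).
Proof.
rewrite -[x]reprNK -[y]reprNK.
by rewrite !(piN_scale, piN_mul) malg_scaleAr.
Qed.

HB.instance Definition _ := GRing.Lalgebra_isAlgebra.Build K N scaleNAr.

Lemma piN0 : piN 0 = 0. Proof. exact: raddf0. Qed.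
Lemma piNM a b : piN (a * b) = piN a * piN b.
Proof. exact: esym (piN_mul a b). Qed.
Lemma piNZ c a : piN (c *: a) = c *: piN a.
Proof. exact: esym (piN_scale c a). Qed.

Definition xgen (n : int) : N := piN (freegen F n).

Lemma xgen_rel k l :
  xgen (k + 1) * xgen l - qvar F ^- 2 *: (xgen l * xgen (k + 1)) =
  qvar F ^- 2 *: (xgen k * xgen (l + 1)) - xgen (l + 1) * xgen k.
Proof.
have: piN (Nrel F k l) = piN 0.
  by apply/piN_eq; rewrite subr0; apply/ideal_genP/ideal_gen_in; exists k, l.
rewrite /Nrel !(piNB, piNZ, piNM) piN0 => /eqP.
by rewrite subr_eq0 => /eqP.
Qed.

Definition gcoef (r : nat) : K :=
  if r is r'.+1 then (qvar F ^+ 4 - 1) * qvar F ^+ (2 * r') else qvar F ^+ 2.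

Lemma qvar_neq0 : qvar F != 0.
Proof. by rewrite expf_neq0 // tofrac_eq0 polyX_eq0. Qed.

(* (t - q^-2) * \sum_r gcoef r t^r = q^-2 t - 1, coefficientwise: gcoef is the
   Taylor series at t = 0 of (q^-2 t - 1) / (t - q^-2). *)
Lemma gcoef_taylor r :
  (if r is r'.+1 then gcoef r' else 0) - qvar F ^- 2 * gcoef r =
  qvar F ^- 2 * (r == 1%N)%:R - (r == 0%N)%:R.
Proof.
have q2 : qvar F ^+ 2 != 0 by rewrite expf_neq0 // qvar_neq0.
case: r => [|[|r]] /=.
- by rewrite mulVf // mulr0 add0r.
- rewrite muln0 expr0 !mulr1 subr0 mulrBr mulr1 (exprD _ 2 2) mulKf //.
  by rewrite opprB addrC subrK.
- by rewrite mulnS exprD mulrCA mulKf // subrr mulr0 subr0.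
Qed.

(* Om k is the coefficient of u^-k.  The sum over r >= 0 in the recursion for
   Om k (x_m a) is finite because Om (k - r) a vanishes for large r; it is cut
   at any r0 beyond which these values vanish. *)
Definition is_Omega_psi (Om : int -> {linear N -> N}) : Prop :=
  [/\ forall k, Om k 1 = 0,
      forall k a, exists r0 : nat,
        forall r : nat, (r0 <= r)%N -> Om (k - r%:Z) a = 0
    & forall k m a (r0 : nat),
        (forall r : nat, (r0 <= r)%N -> Om (k - r%:Z) a = 0) ->
        Om k (xgen m * a) =
          (k == - m)%:R *: a
          + \sum_(r < r0) gcoef r *: (xgen (m + r%:Z) * Om (k - r%:Z) a)].

End NqAlgebra.

(* Main.v *)
Require Import Defs.
From HB Require Import structures.
From mathcomp Require Import all_boot all_order all_algebra sesquilinear.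
From mathcomp Require Import finmap.
From mathcomp Require Import multinomials.monalg.
From mathcomp Require Import zify.

Import GRing.Theory.
Local Open Scope ring_scope.

Import Order.TTheory.

(** Ordered monomials x_{m_1} ... x_{m_k} with m_1 >= ... >= m_k form an
    orthogonal family for the form, none of them is isotropic, and they span
    N_q^-.  Pairing u = sum_w c_w w with an ordered monomial w thus gives
    c_w (w, w), so a vector u of the radical has all its c_w equal to 0.

    Orthogonality.  In Omega_psi(-a) (x_{m_1} ... x_{m_k}) the term that
    deletes x_{m_l} raises the earlier indices by a total of m_l - a, so it
    only occurs when m_l >= a.  If every m_i < a, nothing is left
    ([Omega_above]).  If a is the largest index, only the deletions of an
    m_l equal to a survive, with all raises 0, and for an ordered monomial
    their coefficients g(0)^i = q^{2i} add up to a quantum integer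
    ([Omega_top]).  By adjunction and symmetry two ordered monomials are
    compared letter by letter from the left: at the first difference the pairing
    vanishes ([form_mon_orthogonal]), and the norm of an ordered monomial is a
    product of quantum integers, nonzero because q is an indeterminate
    ([form_mon_norm]).

    Spanning ([ordered_span_mon]).  For a < b the defining relation reads
    x_a x_b = q^2 x_b x_a + q^2 x_{a+1} x_{b-1} - x_{b-1} x_{a+1}.  The new
    pairs have the same sum, entries between a and b, and a second entry
    smaller than b, so replacing an ascent in this way decreases
    sum_i i (m_i - lo), where lo bounds all indices from below.  The one
    exception is b = a + 1, where x_a x_b reappears on the right, with
    coefficient -1; moving it to the left and dividing by 2 gives
    x_a x_{a+1} = q^2 x_{a+1} x_a. *)

(** * Ascents in words of integers *)

Section Words.
Implicit Types (a b c d lo m : int) (s t p : seq int).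

Lemma not_sortedP s : ~~ sorted >=%R s ->
  exists p a b t, s = p ++ [:: a, b & t] /\ a < b.
Proof.
elim: s => [|a [|b s] IH] //=.
rewrite negb_and; have [le_ba /= /IH|lt_ab _] := leP b a.
  by case=> p [c [d [t [-> lt_cd]]]]; exists (a :: p), c, d, t.
by exists [::], a, b, s.
Qed.

Definition height lo s : nat := \sum_(m <- s) `|m - lo|%N.

(** This is sum_i i (m_i - lo), with positions counted from 0: m_i is
    counted once in the height of each of the i tails that strictly contain
    it. *)
Fixpoint weight lo s : nat :=
  if s is _ :: s' then height lo s' + weight lo s' else 0.

(** Both pairs contribute equally to every tail containing the whole pair;
    only the tail that starts at the second entry sees the decrease from b
    to d. *)
Lemma weight_lt lo p t a b c d : lo <= a -> a <= c -> a <= d -> d < b ->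
  c + d = a + b ->
  (weight lo (p ++ [:: c, d & t]) < weight lo (p ++ [:: a, b & t]))%N.
Proof.
move=> le_lo_a le_ac le_ad lt_db cd_ab.
have heightE s : height lo (s ++ [:: c, d & t]) = height lo (s ++ [:: a, b & t]).
  by rewrite /height !big_cat !big_cons /=; lia.
elim: p => [|m p IH] /=; last by rewrite heightE ltn_add2l.
by rewrite /height !big_cons; lia.
Qed.

End Words.

(** * Ordered monomials span *)

Section Straightening.
Variable F : fieldType.
Local Notation K := (qfield F).
Local Notation N := (Nq F).
Local Notation q := (qvar F).
Implicit Types (k l m lo : int) (s t : seq int) (x y : N).

Definition mon s : N := \prod_(m <- s) xgen F m.

Lemma mon_cons m s : mon (m :: s) = xgen F m * mon s.
Proof. exact: big_cons. Qed.

Lemma piN_mon (w : {fmonom int}) : piN (mkmalgU w 1 : freealg F) = mon w.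
Proof.
case: w => s; elim: s => [|m s IH].
  rewrite /mon big_nil -[RHS](rmorph1 (@piN F)); congr (piN _).
  by congr mkmalgU; apply/eqP; rewrite fmP /= fm1.
rewrite /mon big_cons -[X in _ * X]IH /xgen -piNM; congr (piN _).
rewrite /freegen; rewrite [RHS]fgmulUU mulr1; congr mkmalgU.
by apply/eqP; rewrite fmP fmM fmU.
Qed.

Lemma piN_sum_mon (a : freealg F) :
  piN a = \sum_(w <- msupp a) mcoeff w a *: mon w.
Proof.
rewrite {1}[a]monalgE raddf_sum; apply: eq_bigr => w _.
rewrite -piN_mon -piNZ; congr (piN _).
by apply/malgP => v; rewrite mcoeffZ !mcoeffU mulrnAr mulr1.
Qed.

(** Phrased through the free algebra, so that an element comes with a
    finitely supported family of coefficients indexed by ordered words. *)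
Definition ordered_span (x : N) : Prop :=
  exists2 a : freealg F, x = piN a &
    forall w : {fmonom int}, ~~ sorted >=%R w -> mcoeff w a = 0.

Lemma ordered_span0 : ordered_span 0.
Proof. by exists 0 => [|w _]; rewrite ?piN0 ?mcoeff0. Qed.

Lemma ordered_spanD x y :
  ordered_span x -> ordered_span y -> ordered_span (x + y).
Proof.
move=> [a -> aP] [b -> bP]; exists (a + b) => [|w Nw]; first by rewrite raddfD.
by rewrite mcoeffD aP ?bP ?addr0.
Qed.

Lemma ordered_spanZ (c : K) x : ordered_span x -> ordered_span (c *: x).
Proof.
move=> [a -> aP]; exists (c *: a) => [|w Nw]; first by rewrite piNZ.
by rewrite mcoeffZ aP ?mulr0.
Qed.

Lemma ordered_span_sorted s : sorted >=%R s -> ordered_span (mon s).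
Proof.
move=> ss; exists (mkmalgU (FMonom s) 1) => [|w Nw].
  by rewrite piN_mon.
by rewrite mcoeffU; case: eqP Nw => [<-|//]; rewrite /= ss.
Qed.

(** The defining relation, solved for its term in x_k x_l: all other terms
    have a smaller second index once l > k + 1. *)
Lemma xgen_swap k l : xgen F k * xgen F l =
  q ^+ 2 *: (xgen F l * xgen F k) + q ^+ 2 *: (xgen F (k + 1) * xgen F (l - 1))
  - xgen F (l - 1) * xgen F (k + 1).
Proof.
have q2 : q ^+ 2 != 0 by rewrite expf_neq0 // qvar_neq0.
have := xgen_rel F k (l - 1); rewrite subrK => /(congr1 (GRing.scale (q ^+ 2))).
rewrite !scalerBr !scalerA mulfV // !scale1r => E.
by rewrite -[LHS](subrK (q ^+ 2 *: (xgen F l * xgen F k))) -E [LHS]addrC addrA.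
Qed.

(** For l = k + 1 the last term of [xgen_swap] is again x_k x_{k+1}, so the
    relation only determines twice this product. *)
Lemma xgen_swap_succ k : (2%:R : K) != 0 ->
  xgen F k * xgen F (k + 1) = q ^+ 2 *: (xgen F (k + 1) * xgen F k).
Proof.
move=> nz2; apply: (scalerI nz2); have := xgen_swap k (k + 1).
rewrite addrK => /eqP; rewrite -subr_eq opprK => /eqP E.
by rewrite !scaler_nat !mulr2n.
Qed.

(** Straightening: rewrite an ascent and recurse on the weight.  The
    bound lo is kept throughout since the new indices lie between the old
    ones. *)
Lemma ordered_span_mon s : (2%:R : K) != 0 -> ordered_span (mon s).
Proof.
move=> nz2.
have [lo] : exists lo : int, all (>= lo) s.
  elim: s => [|m s [lo all_lo]]; first by exists 0.
  exists (Order.min m lo); rewrite /= ge_min lexx /=.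
  by apply: sub_all all_lo => i /=; rewrite ge_min orbC => ->.
have [n] := ubnP (weight lo s); elim: n s => // n IH s lt_n all_lo.
have [/ordered_span_sorted //|/not_sortedP [p [a [b [t [Ds lt_ab]]]]]] :=
  boolP (sorted >=%R s).
move: all_lo; rewrite Ds all_cat /= => /and4P [all_p lo_a lo_b all_t].
have step c d : a <= c -> a <= d -> d < b -> c + d = a + b ->
    ordered_span (mon p * (xgen F c * xgen F d) * mon t).
  move=> le_ac le_ad lt_db cd_ab.
  have -> : mon p * (xgen F c * xgen F d) * mon t = mon (p ++ [:: c, d & t]).
    by rewrite /mon big_cat !big_cons -!mulrA.
  apply: IH; last by rewrite all_cat /= all_p all_t andbT /=; lia.
  by apply: leq_trans (weight_lt _ p t _ _ _ _ lo_a le_ac le_ad lt_db cd_ab) _;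
    rewrite -Ds.
have -> : mon (p ++ [:: a, b & t]) = mon p * (xgen F a * xgen F b) * mon t.
  by rewrite /mon big_cat !big_cons -!mulrA.
have [Db|neq_b] := eqVneq b (a + 1).
  rewrite Db xgen_swap_succ // -scalerAr -scalerAl.
  by apply/ordered_spanZ/step; lia.
rewrite xgen_swap !(mulrDl, mulrDr) -scaleN1r -!(scalerAr, scalerAl).
by apply: ordered_spanD; first apply: ordered_spanD;
  apply: ordered_spanZ; apply: step; lia.
Qed.

Lemma ordered_span_all x : (2%:R : K) != 0 -> ordered_span x.
Proof.
move=> nz2; rewrite -[x]reprNK piN_sum_mon.
elim/big_ind: _ => [||w _]; [exact: ordered_span0|exact: ordered_spanD|].
exact/ordered_spanZ/ordered_span_mon.
Qed.

End Straightening.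

(** * Orthogonality of ordered monomials *)

Section Orthogonality.
Variables (F : fieldType) (Om : int -> {linear Nq F -> Nq F}).
Hypothesis OmP : is_Omega_psi Om.
Local Notation K := (qfield F).
Local Notation N := (Nq F).
Local Notation q := (qvar F).
Implicit Types (a m : int) (s t : seq int).

(** The quantum integer [n] of q^2, (1 - q^{2n}) / (1 - q^2). *)
Definition qnat (n : nat) : K := \sum_(i < n) q ^+ (2 * i).

(** It is a polynomial in q^{1/2} with constant term 1. *)
Lemma qnatS_neq0 n : qnat n.+1 != 0.
Proof.
have -> : qnat n.+1 = tofrac (\sum_(i < n.+1) 'X ^+ (2 * (2 * i)) : {poly F}).
  rewrite rmorph_sum; apply: eq_bigr => i _.
  by rewrite rmorphXn [in RHS]exprM.
rewrite tofrac_eq0; apply/eqP => /(congr1 (fun p : {poly F} => p.[0])).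
rewrite horner_sum big_ord_recl hornerXn big1 => [|i _].
  by rewrite horner0 addr0 => /eqP; rewrite oner_eq0.
by rewrite hornerXn expr0n.
Qed.

(** The recursion calls Omega_psi(-a - r) with r >= 0 on the rest of the word,
    and a + r again exceeds all its indices, so that the recursive sum is
    empty. *)
Lemma Omega_above a s : all (< a) s -> Om (- a) (mon F s) = 0.
Proof.
case: OmP => Om1 _ OmM.
elim: s a => [|m s IH] a /=; first by rewrite /mon big_nil Om1.
case/andP=> lt_ma all_s; rewrite mon_cons (OmM _ _ _ 0%N).
  by rewrite big_ord0 addr0 eqr_opp gt_eqF // scale0r.
move=> r _; rewrite -opprD; apply: IH.
by apply: sub_all all_s => i /=; lia.
Qed.

(** Only the r = 0 term of the recursion survives, by [Omega_above].  Each
    letter equal to a is deleted in turn, and every equal letter passed over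
    on the way contributes a factor g(0) = q^2. *)
Lemma Omega_top a s : sorted >=%R (a :: s) ->
  Om (- a) (mon F (a :: s)) = qnat (count_mem a s).+1 *: mon F s.
Proof.
case: OmP => Om1 _ OmM.
have above s' r : sorted >=%R (a :: s') -> (1 <= r)%N ->
    Om (- a - r%:Z) (mon F s') = 0.
  rewrite /= path_sortedE; last exact: rev_trans le_trans.
  case/andP=> all_s _ r_gt0; rewrite -opprD; apply: Omega_above.
  by apply: sub_all all_s => i /=; lia.
elim: s => [|b s IH] sorted_s.
  rewrite mon_cons (OmM _ _ _ 1%N) => [|r]; last exact: above.
  by rewrite eqxx big_ord1 subr0 /mon big_nil Om1 mulr0 scaler0 addr0 /qnat big_ord1 expr0.
rewrite mon_cons (OmM _ _ _ 1%N) => [|r]; last exact: above.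
rewrite eqxx scale1r big_ord1 /= subr0 addr0.
have [Db|neq_ba] := eqVneq b a.
  subst b; rewrite IH; last by case/andP: sorted_s.
  rewrite add1n -scalerAr scalerA -mon_cons -[X in X + _]scale1r -scalerDl.
  congr (_ *: _); rewrite [in RHS]/qnat big_ord_recl expr0; congr (_ + _).
  rewrite mulr_sumr; apply: eq_bigr => i _.
  by rewrite -exprD /bump -mulnS.
have lt_ba : b < a by case/andP: sorted_s => ? _; rewrite lt_neqAle neq_ba.
have all_s : all (< a) (b :: s).
  have: all (<= b) s.
    have /= := path_sorted sorted_s; rewrite path_sortedE; last exact: rev_trans le_trans.
    by case/andP.
  by rewrite /= lt_ba => /sub_all; apply => i /=; lia.
rewrite (Omega_above _ _ all_s) mulr0 scaler0 addr0 add0n.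
have /count_memPn -> : a \notin s.
  case/andP: all_s => _ /allP all_s; apply/negP => /all_s /=.
  by rewrite ltxx.
by rewrite /qnat big_ord1 expr0 scale1r.
Qed.

Variable form : {symmetric Nq F}.
Hypothesis form11 : form 1 1 = 1.
Hypothesis form_adj : forall (m : int) (a b : Nq F),
  form (xgen F m * a) b = form a (Om (- m) b).

Lemma formC x y : form x y = form y x.
Proof. by rewrite hermC /= expr0 mul1r. Qed.

Lemma formZr c x y : form x (c *: y) = c * form x y.
Proof. by rewrite linearZr_LR. Qed.

Lemma formZl c x y : form (c *: x) y = c * form x y.
Proof. by rewrite linearZl_LR. Qed.

Lemma form_mon_above a s t : all (< a) t -> form (mon F (a :: s)) (mon F t) = 0.
Proof. by move=> lt_t; rewrite mon_cons form_adj Omega_above // linear0r. Qed.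

(** Compare first letters: if they differ, the word with the larger one is
    orthogonal to the other, by symmetry in whichever argument it stands; if
    they agree, [Omega_top] strips them both. *)
Lemma form_mon_orthogonal s t : sorted >=%R s -> sorted >=%R t -> s != t ->
  form (mon F s) (mon F t) = 0.
Proof.
elim: s t => [|a s IH] [|b t] // ss st neq_st.
- by rewrite formC form_mon_above.
- by rewrite form_mon_above.
have below (c d : int) r : sorted >=%R (c :: r) -> c < d -> all (< d) (c :: r).
  rewrite /= path_sortedE; last exact: rev_trans le_trans.
  by case/andP=> all_r _ lt_cd; rewrite lt_cd; apply: sub_all all_r => i /=; lia.
have [lt_ab|lt_ba|Dab] := ltgtP a b.
- by rewrite formC form_mon_above //; apply: below ss _.
- by rewrite form_mon_above //; apply: below st _.
subst b; rewrite mon_cons form_adj Omega_top // formZr IH ?mulr0 //.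
- exact: path_sorted ss.
- exact: path_sorted st.
by apply: contraNneq neq_st => ->.
Qed.

Lemma form_mon_norm s : sorted >=%R s -> form (mon F s) (mon F s) != 0.
Proof.
elim: s => [|a s IH] ss; first by rewrite /mon big_nil form11 oner_eq0.
rewrite {1}mon_cons form_adj Omega_top // formZr mulf_neq0 ?qnatS_neq0 //.
by apply/IH/path_sorted/ss.
Qed.

End Orthogonality.

(** * Non-degeneracy *)

Theorem corollary4p0p3 (F : fieldType) (charF : [pchar F] =i pred0)
    (Om : int -> {linear Nq F -> Nq F}) (OmP : is_Omega_psi Om)
    (form : {symmetric Nq F})
    (form11 : form 1 1 = 1)
    (form_adj : forall (m : int) (a b : Nq F),
       form (xgen F m * a) b = form a (Om (- m) b))
    (u : Nq F) :
  (forall v : Nq F, form u v = 0) -> u = 0.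
Proof.
move=> u_perp.
have nz2 : (2%:R : qfield F) != 0.
  rewrite -(rmorph_nat (@tofrac {poly F})) tofrac_eq0 -polyC_natr polyC_eq0.
  by apply/negP => two0; have := charF 2%N; rewrite !inE two0.
have [a Da a_sorted] := ordered_span_all F u nz2.
suff a0 : a = 0 by rewrite Da a0 piN0.
apply/malgP => w; rewrite mcoeff0.
have [sw|/a_sorted //] := boolP (sorted >=%R (w : seq int)).
have := u_perp (mon F w); rewrite Da piN_sum_mon linear_sumlz.
have [w_a|/mcoeff_outdom //] := boolP (w \in msupp a).
rewrite (big_fsetD1 w) //= big1_seq => [|v].
  rewrite addr0 formZl => /eqP; rewrite mulf_eq0.
  by rewrite (negPf (form_mon_norm _ _ OmP _ form11 form_adj _ sw)) orbF => /eqP.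
rewrite !inE => /andP [_ /andP [neq_vw]]; rewrite -mcoeff_neq0 => nz_v.
rewrite formZl (form_mon_orthogonal _ _ OmP _ form_adj) ?mulr0 //.
by apply: contraNT nz_v => /a_sorted ->.
Qed.
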